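(* Let $(X,T)$ be a minimal dynamical system. There exists a residual set $X' \subseteq X$ such that for all $x \in X'$ and all non-empty, open $U \subseteq X$, the set $R(x,U)$ contains arbitrarily long geometric progressions; that is, for every $\ell \in \mathbb{N}$ there exist $n, m \in \mathbb{N}$ with $m \geq 2$ such that $\{nm, nm^2, \ldots, nm^\ell\} \subseteq R(x,U)$.
   Context: $\mathbb{N}$ is the set of positive integers. A (topological dynamical) system $(X,T)$ is a compact metric space $X$ together with a continuous map $T: X \to X$ (not assumed invertible). It is minimal if for all $x \in X$ the set $\{T^n x \mid n \in \mathbb{N}\}$ is dense in $X$. For $x \in X$ and $U \subseteq X$ non-empty and open, $R(x,U) = \{n \in \mathbb{N} \mid T^n x \in U\}$. A set is residual if it contains a dense $G_\delta$ set. *)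

(* Defs.v *)
From HB Require Import structures.
From mathcomp Require Import all_boot all_order all_algebra.
From mathcomp Require Import all_classical all_reals all_analysis.
From mathcomp Require Import borel_hierarchy.

Set Implicit Arguments.
Unset Strict Implicit.
Unset Printing Implicit Defensive.

Local Open Scope classical_set_scope.

(* The positive integers are rendered throughout by [nat] together with an
   explicit positivity condition. *)

Definition dynamical_system (R : realType) (X : metricType R) (T : X -> X) : Prop :=
  compact [set: X] /\ continuous T.

(* Forward orbits start at [T x], not at [x]. *)
Definition minimal_system (X : topologicalType) (T : X -> X) : Prop :=
  forall x : X, dense [set iter n T x | n in [set n : nat | (0 < n)%N]].

Definition return_times (X : Type) (T : X -> X) (x : X) (U : set X) : set nat :=
  [set n : nat | (0 < n)%N /\ U (iter n T x)].

Definition residual (X : topologicalType) (A : set X) : Prop :=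
  exists2 G : set X, Gdelta G /\ dense G & G `<=` A.

(* {n m, n m^2, ..., n m^l} *)
Definition geometric_progression (n m l : nat) : set nat :=
  [set (n * m ^ i)%N | i in [set i : nat | (1 <= i <= l)%N]].

Definition has_long_geometric_progressions (A : set nat) : Prop :=
  forall l : nat, (0 < l)%N ->
    exists n m : nat,
      [/\ (0 < n)%N, (2 <= m)%N & geometric_progression n m l `<=` A].

(* Main.v *)
Require Import Defs.
From mathcomp Require Import all_boot all_order all_algebra.
From mathcomp Require Import all_classical all_reals all_analysis.
From mathcomp Require Import ring zify.
Set Implicit Arguments.
Unset Strict Implicit.
Unset Printing Implicit Defensive.
Import Order.TTheory GRing.Theory Num.Theory.
Import numFieldNormedType.Exports.
Local Open Scope ring_scope.

(** Fix an open set U and a length l. The points x for which R(x, U) contains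
    a geometric progression of length l form an open set; once it is known to
    be dense, the theorem follows from the Baire category theorem, since in a
    compact metric space countably many balls U suffice, namely finitely many
    of each radius 1 / (n + 1).

    For density, let V be open and nonempty. By minimality some T^r, with
    r > 0, carries a point of V into U, so W, the intersection of V with the
    preimage of U under T^r, is open and nonempty. Look for progressions with
    n = r and m = d + 1. The differences

      n m^i - r = r ((1 + d)^i - 1)

    are values at d of integer polynomials without constant term, so the
    polynomial recurrence theorem gives a point x of W and d > 0 such that all
    T^(r m^i - r) x lie in W as well. Then x is in V, and T^(n m^i) x is in U
    for every i ([geometric_return_points_dense]).

    Polynomial recurrence ([polynomial_recurrence]) is read off an orbit: by
    compactness, the times at which the orbit of a point visits W have bounded
    gaps, so colouring a time by its distance to a later visit uses finitely
    many colours. A monochromatic configuration {a, a + p(d)} translates into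
    visits of W that differ by the p(d).

    Such configurations come from the polynomial van der Waerden theorem of
    Bergelson and Leibman ([polynomial_van_der_waerden]), which is proved here
    by Walters' combinatorial argument. A family A of polynomials is replaced
    by the polynomials p(x + d) - p(d) - q(x), for p in A, bounded d, and a
    fixed q of least degree in A. Colour focusing shows that it is enough to
    treat this new family ([color_focusing], [pet_step]). The new family is
    simpler: degrees do not grow, leading coefficients above the degree of q
    are unchanged, and at the degree of q there is one leading coefficient
    less. This is the PET induction, or polynomial exhaustion
    ([pet_induction]). *)

(** * Polynomial configurations and colour focusing *)

(** The bound [N], uniform over all colourings, is what makes it possible to
    place the configuration anywhere by translating the colouring, and to work
    inside a window of known length. Quantifying over all finite types of
    colours allows passing to colourings by patterns. *)
Definition poly_partition_regular (A : seq {poly int}) : Prop :=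
  forall K : finType, exists N : nat, forall c : int -> K,
    exists a : int, exists d : nat,
      [/\ `|a| <= N%:Z, (0 < d <= N)%N &
        forall p : {poly int}, p \in A -> c (a + p.[d%:Z]) = c a].

Lemma horner_bounded (A : seq {poly int}) (N : nat) :
  exists B : nat, forall (p : {poly int}) (d : nat),
    p \in A -> (d <= N)%N -> `|p.[d%:Z]| <= B%:Z.
Proof.
exists (\sum_(p <- A) \sum_(d < N.+1) `|p.[d%:Z]|%N)%N => p d pA dN.
rewrite -abszE lez_nat (big_rem p) //= (bigD1 (Ordinal (dN : d < N.+1)%N)) //=.
by rewrite -!addnA leq_addr.
Qed.

(** The simpler family to which colour focusing reduces [A]. For each p in [A],
    p(x + d) - p(d) is the displacement accumulated between the times d and
    d + x, and subtracting [q] accounts for moving the focus. *)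
Definition pet_derivative (A : seq {poly int}) (q : {poly int}) (N : nat) :=
  [seq p \Po ('X + d%:Z%:P) - p.[d%:Z]%:P - q | p <- A, d <- iota 0 N.+1].

Lemma pet_derivativeP (A : seq {poly int}) (q p : {poly int}) (N d : nat) :
  p \in A -> (d <= N)%N ->
  p \Po ('X + d%:Z%:P) - p.[d%:Z]%:P - q \in pet_derivative A q N.
Proof. by move=> pA dN; apply: allpairs_f => //; rewrite mem_iota. Qed.

(** Apply partition regularity to the colouring of an integer by the whole
    pattern of colours in the window of radius [L] around it. *)
Lemma pattern_recurrence (A : seq {poly int}) (K : finType) (L : nat) :
  poly_partition_regular A ->
  exists N : nat, forall c : int -> K, exists b : int, exists e : nat,
    [/\ `|b| <= N%:Z, (0 < e <= N)%N &
      forall (p : {poly int}) (x : int), p \in A -> `|x| <= L%:Z ->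
        c (b + p.[e%:Z] + x) = c (b + x)].
Proof.
move=> /(_ {ffun 'I_(L + L).+1 -> K}) [N HN]; exists N => c.
(* The index j of the pattern stands for the offset j - L. *)
have [b [e [bN eN cb]]] := HN (fun x => [ffun j : 'I__ => c (x + (j%:Z - L%:Z))]).
exists b, e; split=> // p x pA xL.
pose j := absz (x + L%:Z); have jL : (j < (L + L).+1)%N by rewrite /j; lia.
have /ffunP/(_ (Ordinal jL)) := cb p pA; rewrite !ffunE /=.
by have -> : j%:Z - L%:Z = x by rewrite /j; lia.
Qed.

(** Colour focusing: either a monochromatic configuration appears, or there is
    a focus [a] at which [r] distinct colours are each seen along all of [A] at
    some time. One more colour is gained as follows. A focus [a] with colours C,
    taken near a centre [b] whose surroundings repeat under the derived family
    at time [e], is moved to [b + a - q(e)]. Each old time [d] becomes [e + d],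
    because [p(e + d) - q(e)] differs from [p(d)] by a value of the derived
    family; and [e] itself, the case d = 0, now sees the colour of [b + a]. If
    that colour already belonged to C, then [b + a] together with the
    corresponding time would be monochromatic. *)
Lemma color_focusing (A : seq {poly int}) (q : {poly int}) (K : finType) (r : nat) :
  (forall p : {poly int}, p \in A -> p.[0] = 0) ->
  (forall N, poly_partition_regular (pet_derivative A q N)) ->
  (r <= #|K|)%N ->
  exists N : nat, forall c : int -> K,
    (exists a : int, exists d : nat,
      [/\ `|a| <= N%:Z, (0 < d <= N)%N &
        forall p : {poly int}, p \in A -> c (a + p.[d%:Z]) = c a])
    \/ exists a : int, exists C : {set K},
      [/\ `|a| <= N%:Z, #|C| = r &
        forall k, k \in C -> exists2 d : nat, (0 < d <= N)%N &
          forall p : {poly int}, p \in A -> c (a + p.[d%:Z]) = k].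
Proof.
move=> A0 recA; elim: r => [|r IHr] rK.
  exists 0%N => c; right; exists 0, finset.set0; split; rewrite ?cards0 //.
  by move=> k; rewrite finset.inE.
have [N HN] := IHr (ltnW rK).
have [B HB] := horner_bounded A N.
have [M HM] := @pattern_recurrence _ K (N + B) (recA N).
have [B' HB'] := horner_bounded [:: q] M.
(* The new focus is b + a - q(e), with |b|, e <= M, |a|, d <= N and
   |q(e)| <= B'. *)
exists (M + N + B')%N => c.
have [b [e [bM eM cb]]] := HM c.
have [[a [d [aN dN mono]]]|[a [C [aN cardC foc]]]] := HN (fun x => c (b + x)).
  left; exists (b + a), d; split; [lia|lia|].
  by move=> p pA; rewrite -addrA mono.
have [cC|cC] := boolP (c (b + a) \in C).
  have [d dN mono] := foc _ cC.
  left; exists (b + a), d; split; [lia|lia|].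
  by move=> p pA; rewrite -addrA mono.
have qB : `|q.[e%:Z]| <= B'%:Z by apply: HB'; rewrite ?mem_head //; case/andP: eM.
(* At time e + d, the focus b + a - q(e) sees what b + a sees at time d. *)
have shift p d : p \in A -> (d <= N)%N ->
    c (b + a - q.[e%:Z] + p.[(e + d)%N%:Z]) = c (b + (a + p.[d%:Z])).
  move=> pA dN; have pB := HB p d pA dN.
  rewrite -(cb _ (a + p.[d%:Z]) (pet_derivativeP q pA dN)); last lia.
  congr c; rewrite !(hornerD, hornerN, hornerC, horner_comp, hornerX) PoszD; ring.
right; exists (b + a - q.[e%:Z]), (c (b + a) |: C); split; first lia.
  by rewrite cardsU1 cC cardC.
move=> k /finset.setU1P[->|kC].
  exists e; first lia.
  move=> p pA; have := shift p 0%N pA isT.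
  by rewrite addn0 (A0 p pA : p.[0%:Z] = 0) addr0.
have [d dN mono] := foc k kC.
exists (e + d)%N; first lia.
by move=> p pA; rewrite shift ?mono //; case/andP: dN.
Qed.

(** Once as many colours as there are have been focused, the colour of the
    focus itself is one of them. *)
Lemma pet_step (A : seq {poly int}) (q : {poly int}) :
  (forall p : {poly int}, p \in A -> p.[0] = 0) ->
  (forall N, poly_partition_regular (pet_derivative A q N)) ->
  poly_partition_regular A.
Proof.
move=> A0 recA K.
have [N HN] := color_focusing A0 recA (leqnn #|K|).
exists N => c; case: (HN c) => // -[a [C [aN cardC foc]]].
have /foc[d dN mono] : c a \in C.
  suff -> : C = [set: K] by rewrite finset.inE.
  by apply/eqP; rewrite eqEcard finset.subsetT cardsT cardC leqnn.
by exists a, d.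
Qed.

(** * PET induction *)

(** Zero polynomials must be discarded: the derivative of 0 is [- q], which
    would bring back a leading coefficient at the degree of [q]. *)
Lemma poly_partition_regular_filter0 (A : seq {poly int}) :
  poly_partition_regular [seq p <- A | p != 0] -> poly_partition_regular A.
Proof.
move=> recA K; have [N HN] := recA K; exists N => c.
have [a [d [aN dN mono]]] := HN c; exists a, d; split=> // p pA.
have [->|p0] := eqVneq p 0; first by rewrite horner0 addr0.
by apply: mono; rewrite mem_filter p0.
Qed.

Lemma size_lead_shift (p : {poly int}) (d : nat) :
  size (p \Po ('X + d%:Z%:P)) = size p /\
  lead_coef (p \Po ('X + d%:Z%:P)) = lead_coef p.
Proof.
have s2 : size ('X + d%:Z%:P : {poly int}) = 2 by rewrite size_XaddC.
rewrite size_comp_poly2 // lead_coef_comp ?s2 // lead_coefXaddC expr1n mulr1.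
by [].
Qed.

(** Complexity of a family: [S j] bounds the leading coefficients of its
    members of size [j], and nothing is prescribed below size [s]. Recall that
    the size of a nonzero polynomial is its degree plus one. *)
Definition leads_in (s : nat) (S : nat -> seq int) (A : seq {poly int}) : Prop :=
  forall p : {poly int}, p \in A -> p.[0] = 0 /\
    ((s <= size p)%N -> lead_coef p \in S (size p)).

(** Subtracting a polynomial [q] of least size [s] leaves the leading terms of
    larger polynomials alone and translates those of size [s] by the leading
    coefficient of [q]; the polynomials that share the latter drop to a lower
    degree, about which nothing is claimed. *)
Lemma pet_derivative_leads_in (s : nat) (S : nat -> seq int)
    (A : seq {poly int}) (q : {poly int}) (N : nat) :
  (forall p : {poly int}, p \in A -> s <= size p)%N ->
  leads_in s S A -> q \in A -> size q = s -> (0 < s)%N ->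
  leads_in s (fun j => if j == s then [seq x - lead_coef q | x <- S s & x != lead_coef q]
              else S j)
    [seq p <- pet_derivative A q N | p != 0].
Proof.
move=> sA inA qA sq s0 p'; rewrite mem_filter => /andP[p'0 /allpairsP[[p d]]] /=.
case=> pA _ E; have [p0 lp] := inA p pA; have [q0 _] := inA q qA.
split.
  rewrite E !(hornerD, hornerN, hornerC, horner_comp, hornerX).
  by rewrite add0r q0 subrr subr0.
have [sps lps] := size_lead_shift p d.
have sq1 : (size (p.[d%:Z]%:P + q)%R <= s)%N.
  rewrite (leq_trans (size_polyD _ _)) // geq_max sq leqnn andbT.
  by rewrite (leq_trans (size_polyC_leq1 _)).
have {}E : p' = p \Po ('X + d%:Z%:P) - (p.[d%:Z]%:P + q) by rewrite E opprD addrA.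
move=> sp'; have := sA p pA; rewrite leq_eqVlt => /predU1P[sp|sp]; last first.
  have lt : (size (- (p.[d%:Z]%:P + q)) < size (p \Po ('X + d%:Z%:P)))%N.
    by rewrite size_polyN sps (leq_ltn_trans sq1).
  by rewrite E size_polyDl // lead_coefDl // sps lps gtn_eqF // lp // ltnW.
(* A constant q would vanish, since q(0) = 0; hence the constant p(d) does not
   affect the coefficient of index s - 1 in what follows. *)
have s1 : (1 < s)%N.
  rewrite ltn_neqAle s0 andbT; apply/eqP => s1.
  have /size_poly1P[c c0 Ec] : size q == 1%N by rewrite sq -s1.
  by move: q0; rewrite Ec hornerC => /eqP; rewrite (negPf c0).
have lep' : (size p' <= s)%N.
  by rewrite E (leq_trans (size_polyD _ _)) // size_polyN sps -sp geq_max leqnn.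
have sp's : size p' = s by apply/eqP; rewrite eqn_leq lep'.
have lcp' : lead_coef p' = lead_coef p - lead_coef q.
  rewrite {1}/lead_coef sp's E coefB coefD coefC -subn1 subn_eq0 leqNgt s1 /= add0r.
  by rewrite -lps /lead_coef sps -sp sq subn1.
rewrite sp's eqxx lcp'; apply: map_f.
rewrite mem_filter -subr_eq0 -lcp' lead_coef_eq0 p'0 /=.
by have := lp; rewrite -sp => ->.
Qed.

(** The lexicographic induction on complexities, arranged one degree at a time:
    if the families with prescribed leading coefficients and all sizes above
    [s] are partition regular, then arbitrary polynomials of size at most [s]
    may be added to them. The members of size [s] are removed by
    induction on the number of their leading coefficients. Each derivative
    lowers this number but creates arbitrary polynomials of smaller size, which
    are harmless by the induction on [s]. *)
Lemma pet_induction (s : nat) (S : nat -> seq int) :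
  (forall A, leads_in s.+1 S A -> (forall p : {poly int}, p \in A -> s < size p)%N ->
     poly_partition_regular A) ->
  forall A, leads_in s.+1 S A -> poly_partition_regular A.
Proof.
elim: s S => [|s IHs] S recS A inA.
  apply/poly_partition_regular_filter0/recS => p; last first.
    by rewrite mem_filter size_poly_gt0 => /andP[].
  by rewrite mem_filter => /andP[_ /inA].
have main n : forall S', (forall j, s.+1 < j -> S' j = S j)%N -> (size (S' s.+1) < n)%N ->
    forall B, leads_in s.+1 S' B -> poly_partition_regular B.
  elim: n => [//|n IHn] S' SS' sizeS'; apply: (IHs S') => B inB sB.
  have [/hasP[q qB /eqP sq]|/hasPn noq] :=
    boolP (has (fun p : {poly int} => size p == s.+1) B).
    apply: (@pet_step _ q) => [p /inB[]//|N]; apply: poly_partition_regular_filter0.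
    apply: IHn (pet_derivative_leads_in sB inB qB sq _) => // [j sj|].
      by rewrite gtn_eqF // SS'.
    have qS : lead_coef q \in S' s.+1 by have [_] := inB q qB; rewrite sq; apply.
    rewrite eqxx size_map size_filter -ltnS (leq_trans _ sizeS') // ltnS.
    rewrite -(count_predC (fun x : int => x != lead_coef q) (S' s.+1)).
    rewrite -[X in (X < _)%N]addn0 ltn_add2l -has_count; apply/hasP.
    by exists (lead_coef q) => //=; rewrite eqxx.
  apply: recS => p pB; have := sB p pB; rewrite leq_eqVlt eq_sym (negPf (noq p pB)) //=.
  by have [? lp] := inB p pB; move=> sp; split=> // _; rewrite -SS' // lp // ltnW.
pose S' j := if j == s.+1 then
  [seq lead_coef p | p : {poly int} <- A & size p == s.+1] else S j.
apply: (main _ S' _ (ltnSn _)) => [j sj|p pA]; first by rewrite /S' gtn_eqF.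
have [p0 lp] := inA p pA; split=> //; rewrite leq_eqVlt /S' eq_sym => /predU1P[sp|sp].
  by rewrite sp eqxx; apply: map_f; rewrite mem_filter sp eqxx.
by rewrite gtn_eqF // lp.
Qed.

(** Start the induction above the largest size occurring in [A], where the only
    family left is the empty one. *)
Theorem polynomial_van_der_waerden (A : seq {poly int}) :
  (forall p : {poly int}, p \in A -> p.[0] = 0) -> poly_partition_regular A.
Proof.
move=> A0; pose D := (\max_(p <- A) size p)%N.
have AD (p : {poly int}) : p \in A -> (size p <= D)%N by move=> pA; apply: leq_bigmax_seq.
apply: (@pet_induction D (fun=> [::])) => [B inB sB K|p pA]; last first.
  by split; [exact: A0|rewrite ltnNge AD].
exists 1%N => c; exists 0, 1%N; split=> // p pB.
by have [_ /(_ (sB p pB))] := inB p pB.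
Qed.

Local Open Scope classical_set_scope.

(** * Baire category in compact regular spaces *)

Lemma regular_shrink (X : topologicalType) (O : set X) :
  regular_space X -> open O -> O !=set0 ->
  exists2 V : set X, open V /\ V !=set0 & closure V `<=` O.
Proof.
move=> regX oO [x Ox].
have [V /= nV VO] := regX x O (open_nbhs_nbhs (conj oO Ox)).
exists V°; first by split; [exact: open_interior|exists x].
exact: (subset_trans (closureS (@interior_subset _ V)) VO).
Qed.

(** Regularity provides open sets V_n with the closure of V_(n + 1) inside V_n
    and F_n; compactness replaces completeness to find a point in all of
    them. *)
Lemma compact_regular_baire (X : topologicalType) (F : (set X)^nat) :
  compact [set: X] -> regular_space X ->
  (forall i, open (F i) /\ dense (F i)) -> dense (\bigcap_i F i).
Proof.
move=> cX regX odF O O0 oO.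
pose next (i : nat) (W V : set X) :=
  open W /\ W !=set0 -> (open V /\ V !=set0) /\ closure V `<=` W `&` F i.
have step (iW : nat * set X) : exists V : set X, next iW.1 iW.2 V.
  case: iW => i W; have [[oW W0]|nW] := pselect (open W /\ W !=set0); last first.
    by exists set0 => /nW.
  have [oF dF] := odF i.
  have [V ? ?] := regular_shrink regX (openI oW oF) (dF W W0 oW).
  by exists V.
have [f Hf] := choice step.
pose fix V n := if n is n'.+1 then f (n', V n') else O.
have oV n : open (V n) /\ V n !=set0.
  by elim: n => [//|n IHn]; have [] := Hf (n, V n) IHn.
have VS n : closure (V n.+1) `<=` V n `&` F n by have [] := Hf (n, V n) (oV n).
have Vmono m n : (m <= n)%N -> V n `<=` V m.
  elim: n => [|n IHn]; first by rewrite leqn0 => /eqP ->.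
  rewrite leq_eqVlt => /predU1P[->//|/IHn]; apply: subset_trans.
  by move=> x /(@subset_closure _ _)/VS[].
pose G : set_system X := filter_from setT V.
have FG : ProperFilter G.
  apply: filter_from_proper => [|n _]; last by have [] := oV n.
  apply: filter_fromT_filter; first by exists 0%N.
  by move=> i j; exists (maxn i j); rewrite subsetI; split; apply: Vmono;
    rewrite ?leq_maxl ?leq_maxr.
have [x [_]] := cX G FG filterT.
rewrite clusterE => Gx.
have Vx n : (V n `&` F n) x by apply: VS; apply: Gx; exists n.+1.
by exists x; split; [have [] := Vx 0%N|move=> n _; have [] := Vx n].
Qed.

(** This gathers the conditions for the finitely many balls of one radius into
    a single dense open set, to which [compact_regular_baire] applies. *)
Lemma open_dense_bigcap (X : topologicalType) (I : eqType) (s : seq I) (f : I -> set X) :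
  (forall i, i \in s -> open (f i) /\ dense (f i)) ->
  open [set x | forall i, i \in s -> f i x] /\
  dense [set x | forall i, i \in s -> f i x].
Proof.
elim: s => [_|i s IHs odf].
  have -> : [set x | forall i, i \in [::] -> f i x] = setT by apply/seteqP; split.
  by split=> [|O O0 _]; [exact: openT|rewrite setIT].
have -> : [set x | forall j, j \in i :: s -> f j x] =
    f i `&` [set x | forall j, j \in s -> f j x].
  apply/seteqP; split=> x /=.
    by move=> fx; split=> [|j js]; apply: fx; rewrite inE ?eqxx ?js ?orbT.
  by move=> [fi fx] j; rewrite inE => /predU1P[->|/fx].
have [oi di] := odf i (mem_head i s).
have [os ds] : open [set x | forall j, j \in s -> f j x] /\
    dense [set x | forall j, j \in s -> f j x].
  by apply: IHs => j js; apply: odf; rewrite inE js orbT.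
by split; [exact: openI|exact: denseI].
Qed.

(** Compactness in its near-covering form, applied to the filter of all lists
    containing a given one, turns the local covers into a single list. This
    needs no base point, so the space may be empty. *)
Lemma compact_finite_cover (X : topologicalType) (I : eqType) (f : I -> set X) :
  compact [set: X] -> (forall i, open (f i)) -> (forall x, exists i, f i x) ->
  exists s : seq I, forall x, exists2 i, i \in s & f i x.
Proof.
move=> /compact_near_coveringP cX of_ cov.
pose G : set_system (seq I) :=
  filter_from setT (fun s : seq I => [set t : seq I | {subset s <= t}]).
have FG : Filter G.
  apply: filter_fromT_filter; first by exists [::].
  move=> s t; exists (s ++ t) => u /= stu.
  by split=> i /= si; apply: stu; rewrite mem_cat si ?orbT.
have [|s _ Gs] := cX _ G (fun s x => exists2 i, i \in s & f i x) FG.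
  move=> x _; have [i fix_] := cov x.
  exists (f i, [set t : seq I | {subset [:: i] <= t}]) => /=.
    by split; [exact: open_nbhs_nbhs|exists [:: i]].
  by move=> [y t] [/= fy it]; exists i => //; apply: it; exact: mem_head.
by exists s => x; apply: (Gs s).
Qed.

(** * Recurrence in minimal systems *)

Lemma iter_continuous (X : topologicalType) (T : X -> X) (n : nat) :
  continuous T -> continuous (iter n T).
Proof.
move=> cT; elim: n => [|n IHn] x; first exact: cvg_id.
exact: (@continuous_comp _ _ _ (iter n T) T x (IHn x) (cT _)).
Qed.

Lemma open_preimage_iter (X : topologicalType) (T : X -> X) (n : nat) (U : set X) :
  continuous T -> open U -> open (iter n T @^-1` U).
Proof. by move=> cT oU; apply: open_comp => // x _; apply: iter_continuous. Qed.

Lemma minimal_visit (X : topologicalType) (T : X -> X) (x : X) (U : set X) :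
  minimal_system T -> open U -> U !=set0 -> exists2 n, (0 < n)%N & U (iter n T x).
Proof.
move=> minT oU U0; have [y [Uy [n n0 ny]]] := minT x U U0 oU.
by exists n; rewrite // ny.
Qed.

(** The preimages of [U] under the iterates of [T] cover the space, hence
    finitely many of them do. *)
Lemma bounded_return (X : topologicalType) (T : X -> X) (U : set X) :
  compact [set: X] -> continuous T -> minimal_system T -> open U -> U !=set0 ->
  exists N : nat, forall x, exists2 n, (n <= N)%N & U (iter n T x).
Proof.
move=> cX cT minT oU U0.
have [||D cov] := @compact_finite_cover _ _ (fun n => iter n T @^-1` U) cX.
- by move=> n; exact: open_preimage_iter.
- by move=> x; have [n _ Un] := minimal_visit x minT oU U0; exists n.
exists (\max_(n <- D) n)%N => x; have [n nD Ux] := cov x.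
by exists n => //; apply: leq_bigmax_seq.
Qed.

(** Colour the integers by a bounded delay after which the orbit of a point [z]
    visits [W], and follow the orbit from a monochromatic configuration. Only
    values [p(d)] that are natural numbers are meaningful, as [T] need not be
    invertible. *)
Lemma polynomial_recurrence (X : topologicalType) (T : X -> X) (W : set X)
    (A : seq {poly int}) :
  compact [set: X] -> continuous T -> minimal_system T -> open W -> W !=set0 ->
  (forall p : {poly int}, p \in A -> p.[0] = 0) ->
  exists2 x, W x & exists2 d, (0 < d)%N &
    forall p (k : nat), p \in A -> p.[d%:Z] = k%:Z -> W (iter k T x).
Proof.
move=> cX cT minT oW W0 A0; have [z _] := W0.
have [M HM] := bounded_return cX cT minT oW W0.
have visit (n : nat) : exists j : 'I_M.+1, W (iter (n + j) T z).
  have [j jM Wj] := HM (iter n T z).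
  by exists (Ordinal (jM : j < M.+1)%N); rewrite addnC iterD.
have [f Wf] := choice visit.
have [N HN] := polynomial_van_der_waerden A0 'I_M.+1.
(* The configuration starts at a >= - N; translation by N makes it lie in the
   natural numbers, so the absolute value alters no colour that matters. *)
have [a [d [aN /andP[d0 dN] mono]]] := HN (fun x => f (absz (x + N%:Z))).
exists (iter (absz (a + N%:Z)%R + f (absz (a + N%:Z)%R)) T z); first exact: Wf.
exists d => // p k pA pk; rewrite -iterD.
have := Wf (absz (a + k%:Z + N%:Z)%R); rewrite -pk mono // pk.
by rewrite (_ : absz (a + k%:Z + N%:Z)%R = k + absz (a + N%:Z)%R)%N ?addnA //; lia.
Qed.

(** * Points that return along geometric progressions *)

Definition geometric_return_points (X : Type) (T : X -> X) (U : set X) (l : nat) : set X :=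
  [set x | exists n m : nat,
    [/\ (0 < n)%N, (2 <= m)%N & geometric_progression n m l `<=` return_times T x U]].

Lemma geometric_return_points_open (X : topologicalType) (T : X -> X) (U : set X) (l : nat) :
  continuous T -> open U -> open (geometric_return_points T U l).
Proof.
move=> cT oU; rewrite openE => x [n [m [n0 m2 gpU]]].
suff : \forall y \near x, forall i : 'I_l.+1, (1 <= i)%N -> U (iter (n * m ^ i) T y).
  apply: filterS => y Uy; exists n, m; split=> // _ [i /andP[i1 il] <-].
  split; first by rewrite muln_gt0 n0 expn_gt0 (ltnW m2).
  exact: (Uy (Ordinal (il : i < l.+1)%N)).
apply: filter_forall => i.
have [i1|i0] := leqP 1 i; last by apply: nearW => y.
have [_ Ux] : return_times T x U (n * m ^ i)%N.
  by apply: gpU; exists (nat_of_ord i) => //=; rewrite i1 -ltnS ltn_ord.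
have : nbhs x (iter (n * m ^ i) T @^-1` U).
  exact/(open_nbhs_nbhs (conj (open_preimage_iter _ cT oU) Ux)).
by apply: filterS.
Qed.

(** Take [n = r], where T^r maps some point of the given open set [V] into [U].
    The displacements r m^i - r vanish at m = 1, so they are polynomials in
    d = m - 1 without constant term, and recurrence along them of the
    intersection of [V] with the preimage of [U] is what is needed. *)
Lemma geometric_return_points_dense (X : topologicalType) (T : X -> X) (U : set X) (l : nat) :
  compact [set: X] -> continuous T -> minimal_system T -> open U -> U !=set0 ->
  dense (geometric_return_points T U l).
Proof.
move=> cX cT minT oU U0 V [v Vv] oV.
have [r r0 Ur] := minimal_visit v minT oU U0.
pose A : seq {poly int} := [seq r%:Z *: ((1 + 'X) ^+ i - 1) | i <- iota 0 l.+1].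
have A0 (p : {poly int}) : p \in A -> p.[0] = 0.
  move=> /mapP[i _ ->].
  rewrite !(hornerZ, hornerD, hornerN, hornerC, horner_exp, hornerX).
  by rewrite addr0 expr1n subrr mulr0.
have [//||x [Vx Ux] [d d0 rec]] :=
  polynomial_recurrence cX cT minT _ _ A0 (W := V `&` iter r T @^-1` U).
- exact: openI (open_preimage_iter _ cT oU).
- by exists v.
exists x; split=> //; exists r, d.+1; split=> // _ [i /andP[i1 il] <-].
split; first by rewrite muln_gt0 r0 expn_gt0.
have [] := rec (r%:Z *: ((1 + 'X) ^+ i - 1)) (r * (d.+1 ^ i - 1))%N.
- by apply/mapP; exists i => //; rewrite mem_iota.
- rewrite !(hornerZ, hornerD, hornerN, hornerC, horner_exp, hornerX).
  by rewrite PoszM -subzn ?expn_gt0 // -PoszD add1n -rmorphXn.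
- move=> _ /=; rewrite -iterD mulnBr muln1 subnKC //.
  by rewrite leq_pmulr // expn_gt0.
Qed.

Theorem theorem1p1 (R : realType) (X : metricType R) (T : X -> X)
    (hsys : dynamical_system T) (hmin : minimal_system T) :
  exists2 X' : set X, residual X' &
    forall x : X, X' x ->
    forall U : set X, U !=set0 -> open U ->
      has_long_geometric_progressions (return_times T x U).
Proof.
have [cX cT] := hsys.
pose b (n : nat) (w : X) : set X := (ball w (n.+1%:R^-1 : R))°.
have bw n w : b n w w by apply: nbhsx_ballx; rewrite invr_gt0.
have net n : exists D : seq X, forall x, exists2 w, w \in D & b n w x.
  by apply: compact_finite_cover => // [w|x]; [exact: open_interior|exists x].
have [D HD] := choice net.
pose F n := [set x | forall w, w \in D n -> geometric_return_points T (b n w) n x].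
have odF n : open (F n) /\ dense (F n).
  apply: open_dense_bigcap => w _; split.
    exact: geometric_return_points_open (open_interior _).
  by apply: geometric_return_points_dense => //; [exact: open_interior|exists w].
exists (\bigcap_n F n).
  exists (\bigcap_n F n) => //; split; first by exists F => // n; have [] := odF n.
  exact: compact_regular_baire cX uniform_regular odF.
move=> x Fx U [u Uu] oU l l0.
have /nbhs_ballP[e /= e0 eU] : nbhs u U by exact: open_nbhs_nbhs.
have [k ke] : exists k, (k.+1%:R^-1 : R) < e / 2.
  have e2 : 0 < e / 2 by rewrite divr_gt0.
  by have [k] := ltr_add_invr e2; rewrite add0r; exists k.
(* The index n controls both the radius of the balls and the length. *)
pose n := maxn k l.
have ne : (n.+1%:R^-1 : R) < e / 2.
  by apply: le_lt_trans ke; rewrite lef_pV2 ?posrE // ler_nat ltnS leq_maxl.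
have [w wD wu] := HD n u.
have wU : b n w `<=` U.
  move=> y /(@interior_subset _ _) wy; apply: eU; rewrite /= (splitr e).
  apply: (ball_triangle (y := w)).
    by apply/ball_sym/(le_ball (ltW ne)); exact: interior_subset wu.
  exact: le_ball (ltW ne) _ wy.
have [p [m [p0 m2 gp]]] := Fx n I w wD.
exists p, m; split=> // _ [i /andP[i1 il] <-].
have [? bi] : return_times T x (b n w) (p * m ^ i)%N.
  by apply: gp; exists i => //=; rewrite i1 (leq_trans il) // leq_maxr.
by split=> //; exact: wU.
Qed.
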